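(* Let $k\ge2$ and let $\alpha(y_1,\dots,y_k)=c\oplus y_1\oplus\cdots\oplus y_k$, with $c\in GF(2)$, be a linear $k$-adic connective. Consider the growth process $(\mu,\alpha)$ on $n$ variables and assume that the support of $\mu$ contains the negations of the projections. (1) If $\{0,1\}\cap\mathrm{supp}(\mu)=\emptyset$ (no constant function is in the support of $\mu$) and $k$ is odd, then the limiting distribution is uniform over all linear functions of an odd number of variables. (2) If $\{0,1\}\cap\mathrm{supp}(\mu)=\emptyset$ and $k$ is even, then the limiting distribution is uniform over all linear functions of an even number of variables. (3) Otherwise, the limiting distribution is uniform over the set of all $n$-adic linear functions.
   Context: A connective is a $k$-adic Boolean function $\alpha:\{0,1\}^k\to\{0,1\}$. Let $A_0=\{x_1,\dots,x_n,\bar x_1,\dots,\bar x_n,0,1\}$ be the set of projections on $n$ variables, their negations, and the two constant functions. The initial distribution $\mu$ is the uniform distribution on a subset of $A_0$ which contains the $n$ projections, may or may not contain their $n$ negations, and contains neither, one, or both constants. The growth process $(\mu,\alpha)$ gives distributions $\pi_i$ on $n$-adic Boolean functions: $\pi_0=\mu$, and for $i\ge1$, $\pi_i(f)$ is the probability that $\alpha(g_1,\dots,g_k)=f$ where $g_1,\dots,g_k$ are independent random functions distributed according to $\pi_{i-1}$. The support of $\mu$ is $\mathrm{supp}(\mu)=\{f:\mu(f)>0\}$. The limiting distribution is $\pi=\lim_{i\to\infty}\pi_i$ (pointwise); the statement includes that it exists. A function is linear if it has the form $c_0\oplus c_1x_1\oplus\cdots\oplus c_nx_n$ with $c_j\in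 GF(2)$; it is a linear function of an odd (even) number of variables if the number of indices $j\in\{1,\dots,n\}$ with $c_j=1$ is odd (even). *)

(* Defs.v *)
From mathcomp Require Import all_boot all_order all_algebra.
From mathcomp Require Import all_classical reals topology normedtype sequences.

Set Implicit Arguments.
Unset Strict Implicit.
Unset Printing Implicit Defensive.

Import Order.TTheory GRing.Theory Num.Theory.
Import numFieldNormedType.Exports.

Local Open Scope ring_scope.

(* {0,1} = GF(2) is [bool]; its addition is [addb] and its product [andb]. *)
Notation bvec n := {ffun 'I_n -> bool}.
Notation boolfun n := {ffun bvec n -> bool}.

Definition proj_fun n (i : 'I_n) : boolfun n := [ffun x : bvec n => x i].
Definition neg_fun n (f : boolfun n) : boolfun n := [ffun x => ~~ f x].
Definition const_fun n (b : bool) : boolfun n := [ffun => b].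

Definition projs n : {set boolfun n} := [set proj_fun i | i : 'I_n].
Definition neg_projs n : {set boolfun n} := [set neg_fun (proj_fun i) | i : 'I_n].
Definition consts n : {set boolfun n} := [set const_fun n false; const_fun n true].

Definition A0 n : {set boolfun n} := projs n :|: neg_projs n :|: consts n.

Definition comp_fun k n (alpha : boolfun k) (g : {ffun 'I_k -> boolfun n}) :
    boolfun n :=
  [ffun x => alpha [ffun j => g j x]].

Section Distributions.
Variable R : realType.

Definition uniform_on n (S : {set boolfun n}) (f : boolfun n) : R :=
  if f \in S then #|S|%:R^-1 else 0.

Definition supp n (mu : boolfun n -> R) : {set boolfun n} :=
  [set f | 0 < mu f].

(* The negations are present all together or not at all; any subset of the two
   constants is allowed. *)
Definition initial_distribution n (mu : boolfun n -> R) : Prop :=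
  exists S : {set boolfun n},
    [/\ S \subset A0 n,
        projs n \subset S,
        neg_projs n \subset S \/ [disjoint neg_projs n & S]
      & mu = uniform_on S].

(* By independence, the tuple (g_1, ..., g_k) has probability
   \prod_j pi_i (g_j). *)
Fixpoint growth k n (mu : boolfun n -> R) (alpha : boolfun k) (i : nat)
    (f : boolfun n) : R :=
  if i is i'.+1 then
    \sum_(g : {ffun 'I_k -> boolfun n} | comp_fun alpha g == f)
      \prod_(j < k) growth mu alpha i' (g j)
  else mu f.

Definition limiting_distribution k n (mu : boolfun n -> R) (alpha : boolfun k)
    (pi : boolfun n -> R) : Prop :=
  forall f : boolfun n, ((fun i => growth mu alpha i f) @ \oo --> pi f)%classic.

End Distributions.

Definition linear_fun n (c0 : bool) (c : bvec n) : boolfun n :=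
  [ffun x : bvec n => c0 (+) \big[addb/false]_(j < n) (c j && x j)].

Definition linear_funs n : {set boolfun n} :=
  [set f | [exists c0 : bool, exists c : bvec n, f == linear_fun c0 c]].

Definition odd_linear_funs n : {set boolfun n} :=
  [set f | [exists c0 : bool, exists c : bvec n,
     (f == linear_fun c0 c) && odd #|[set j | c j]|]].

Definition even_linear_funs n : {set boolfun n} :=
  [set f | [exists c0 : bool, exists c : bvec n,
     (f == linear_fun c0 c) && ~~ odd #|[set j | c j]|]].

(* Main.v *)
(** On the group of Boolean functions under pointwise [addb], one step of the
    process is the [k]-fold convolution followed by the shift by the constant
    [c]; hence the Fourier coefficients obey [h (i+1) = chi(c) * h i ^ k].  If the
    character [chi] is not constant on the support [S] of [mu], then
    [`|h 0| < 1] and [h i] tends to [0]; if it takes the single value [e] on [S],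
    then [h i = e ^ k] for all [i >= 1].  The uniform distribution on the limit
    set has the same coefficients, and Fourier inversion concludes. *)
Require Import Defs.
From mathcomp Require Import all_boot all_order all_algebra.
From mathcomp Require Import all_classical reals topology normedtype sequences.

Set Implicit Arguments.
Unset Strict Implicit.
Unset Printing Implicit Defensive.

Import Order.TTheory GRing.Theory Num.Theory.
Import numFieldNormedType.Exports.

Local Open Scope ring_scope.

Definition add_fun n (f g : boolfun n) : boolfun n := [ffun x => f x (+) g x].

Lemma add_funK n (h : boolfun n) : involutive (fun f => add_fun f h).
Proof. by move=> f; apply/ffunP => x; rewrite !ffunE addbK. Qed.

(** For a sign [e], only the parity of the exponent matters; this is how the parity of [k] decides
    the limit. *)
Lemma expr_odd (R : pzRingType) (e : R) m : e * e = 1 -> e ^+ m = e ^+ odd m.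
Proof.
move=> ee; rewrite -{1}(odd_double_half m) exprD -muln2 mulnC exprM expr2 ee.
by rewrite expr1n mulr1.
Qed.

(** * Fourier analysis on the group of Boolean functions *)

Section Fourier.
Variables (R : realType) (n : nat).
Implicit Types (t f g h : boolfun n) (p : boolfun n -> R) (S : {set boolfun n}).

(** The characters of the group of Boolean functions under [add_fun], an elementary abelian 2-group
    with one coordinate per point [x]; they are indexed by the group itself. *)
Definition walsh t f : R := \prod_x (-1) ^+ (t x && f x).

Definition fourier p t : R := \sum_f p f * walsh t f.

Lemma walshD t f g : walsh t (add_fun f g) = walsh t f * walsh t g.
Proof.
rewrite /walsh -big_split; apply: eq_bigr => x _ /=.
by rewrite ffunE andb_addr signr_addb.
Qed.

Lemma walsh0 t : walsh t (const_fun n false) = 1.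
Proof. by rewrite /walsh big1 // => x _; rewrite ffunE andbF. Qed.

Lemma walsh_sign t f : exists b : bool, walsh t f = (-1) ^+ b.
Proof.
rewrite /walsh; apply: (big_ind (fun r => exists b : bool, r = (-1) ^+ b)).
- by exists false.
- by move=> _ _ [b ->] [d ->]; exists (b (+) d); rewrite signr_addb.
- by move=> x _; exists (t x && f x).
Qed.

Lemma normr_walsh t f : `|walsh t f| = 1.
Proof. by have [b ->] := walsh_sign t f; rewrite normr_sign. Qed.

Lemma walsh_sqr t f : walsh t f * walsh t f = 1.
Proof. by have [b ->] := walsh_sign t f; rewrite -signr_addb addbb. Qed.

Lemma walshM_neq t f g : walsh t f != walsh t g -> walsh t f * walsh t g = -1.
Proof.
have [b ->] := walsh_sign t f; have [d ->] := walsh_sign t g.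
by case: b d => [] []; rewrite ?eqxx // -signr_addb expr1.
Qed.

(** Choosing [t] means choosing one bit at each point independently, so the sum over [t] factors
    over the points. *)
Lemma sum_walsh f : \sum_t walsh t f = \prod_x (1 + (-1) ^+ f x).
Proof.
transitivity (\prod_(x : bvec n) \sum_(b : bool) ((-1) ^+ (b && f x) : R)).
  by rewrite bigA_distr_bigA.
by apply: eq_bigr => x _; rewrite big_bool /= addrC.
Qed.

(** The summand is the character at [add_fun f g]; a point where [f] and [g] differ gives a factor
    [1 - 1] in the product form of the sum. *)
Lemma walsh_orthogonal f g :
  \sum_t walsh t f * walsh t g = (f == g)%:R * #|{: boolfun n}|%:R.
Proof.
have [->|neq_fg] := eqVneq f g.
  under eq_bigr do rewrite walsh_sqr.
  by rewrite mul1r sumr_const.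
under eq_bigr do rewrite -walshD.
rewrite mul0r sum_walsh; apply/eqP/prodf_eq0.
have [x fgx] : exists x, f x != g x.
  by apply/existsP; rewrite -negb_forall; apply: contra neq_fg => /eqfunP/ffunP ->.
by exists x => //; move: fgx; rewrite ffunE; case: (f x) (g x) => [] [] //; rewrite subrr.
Qed.

Lemma fourier_inversion p f :
  p f = #|{: boolfun n}|%:R^-1 * \sum_t fourier p t * walsh t f.
Proof.
under eq_bigr do rewrite mulr_suml.
rewrite exchange_big /=.
under eq_bigr => g _.
  under eq_bigr do rewrite -mulrA.
  rewrite -mulr_sumr walsh_orthogonal mulrA.
  over.
rewrite -mulr_suml mulrCA mulVf ?mulr1; last first.
  by rewrite pnatr_eq0 -lt0n; apply/card_gt0P; exists f.
rewrite (bigD1 f) //= eqxx mulr1 big1 ?addr0 // => g /negPf->.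
by rewrite mulr0.
Qed.

Lemma fourier_uniform S t :
  fourier (uniform_on R S) t = #|S|%:R^-1 * \sum_(f in S) walsh t f.
Proof.
rewrite /fourier mulr_sumr [RHS]big_mkcond; apply: eq_bigr => f _.
by rewrite /uniform_on; case: ifP; rewrite ?mul0r.
Qed.

Lemma fourier_uniform_const S t (e : R) : (0 < #|S|)%N ->
  {in S, forall f, walsh t f = e} -> fourier (uniform_on R S) t = e.
Proof.
move=> S0 hS; rewrite fourier_uniform (eq_bigr (fun=> e)) //.
by rewrite sumr_const -[e *+ _]mulr_natl mulKf // pnatr_eq0 -lt0n.
Qed.

(** Translation by [h] permutes [S] and flips the sign of the character, so the character sum over
    [S] equals its own negative. *)
Lemma fourier_uniform_shift S t h : walsh t h = -1 ->
  {in S, forall f, add_fun f h \in S} -> fourier (uniform_on R S) t = 0.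
Proof.
move=> th hS; rewrite fourier_uniform; set s := \sum_(f in S) _.
suff /eqP : s = - s by rewrite -addr_eq0 -mulr2n mulrn_eq0 /= => /eqP->; rewrite mulr0.
rewrite {1}/s (reindex_inj (inv_inj (add_funK h))) /= -sumrN; apply: eq_big => f.
  by apply/idP/idP => [/hS|/hS //]; rewrite add_funK.
by rewrite walshD th mulrN1.
Qed.

(** The terms of [f] and [g] are opposite signs and cancel; the terms left have absolute value 1 and
    are fewer than [#|S|]. *)
Lemma fourier_uniform_lt1 S t f g : f \in S -> g \in S ->
  walsh t f != walsh t g -> `|fourier (uniform_on R S) t| < 1.
Proof.
move=> fS gS fg.
have S0 : 0 < #|S|%:R :> R by rewrite ltr0n; apply/card_gt0P; exists f.
rewrite fourier_uniform normrM normfV normr_nat mulrC ltr_pdivrMr // mul1r.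
have gf : g != f by apply: contraNneq fg => ->.
rewrite (bigD1 f) //= (bigD1 g) /=; last by rewrite gS.
have -> : walsh t g = - walsh t f.
  by rewrite -[LHS]mul1r -(walsh_sqr t f) -mulrA walshM_neq ?mulrN1.
rewrite addrA subrr add0r.
apply: le_lt_trans (ler_norm_sum _ _ _) _.
under eq_bigr do rewrite normr_walsh.
rewrite sumr_const ltr_nat; apply/proper_card/properP.
split; first by apply/fintype.subsetP => h /andP[/andP[]].
by exists f => //; apply/negP => /andP[/andP[_ /eqP]].
Qed.

End Fourier.

(** * Evolution of the Fourier coefficients *)

Section Growth.
Variables (R : realType) (k n : nat) (c : bool) (alpha : boolfun k).
Hypothesis alphaE : forall y : bvec k, alpha y = c (+) \big[addb/false]_(j < k) y j.
Implicit Types (t : boolfun n) (mu : boolfun n -> R) (S L : {set boolfun n}).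

Lemma walsh_comp t (g : {ffun 'I_k -> boolfun n}) :
  walsh R t (comp_fun alpha g) = walsh R t (const_fun n c) * \prod_j walsh R t (g j).
Proof.
rewrite /walsh exchange_big -big_split /=; apply: eq_bigr => x _.
rewrite !ffunE alphaE andb_addr signr_addb; congr (_ * _).
rewrite (big_morph (fun b => (-1) ^+ (t x && b)) (id1 := 1) (op1 := *%R)).
- by apply: eq_bigr => j _; rewrite ffunE.
- by move=> b d; rewrite andb_addr signr_addb.
- by rewrite andbF.
Qed.

Lemma fourier_growthS mu i t :
  fourier (growth mu alpha i.+1) t =
  walsh R t (const_fun n c) * fourier (growth mu alpha i) t ^+ k.
Proof.
rewrite {1}/fourier /=.
under eq_bigr do rewrite mulr_suml.
rewrite (exchange_big_dep predT) //=.
under eq_bigr => g _.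
  (* With the tuple [g] outermost, the inner sum has the single term [f = comp_fun alpha g]. *)
  rewrite (eq_bigl (pred1 (comp_fun alpha g))); last by move=> f; rewrite eq_sym.
  rewrite big_pred1_eq walsh_comp mulrCA -big_split /=.
  over.
rewrite -mulr_sumr; congr (_ * _).
(* Independence: the sum over tuples of a product is the product of [k] equal sums. *)
rewrite -(bigA_distr_bigA (fun (_ : 'I_k) g => _ g * _ g)).
by rewrite prodr_const card_ord.
Qed.

Lemma fourier_growth_cvg0 mu t : (2 <= k)%N -> `|fourier mu t| < 1 ->
  ((fun i => fourier (growth mu alpha i) t) @ \oo --> 0)%classic.
Proof.
move=> k2; set r := `|fourier mu t| => r1.
have bound i : `|fourier (growth mu alpha i) t| <= r ^+ i.+1.
  elim: i => [|i IH]; first by rewrite expr1.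
  rewrite fourier_growthS normrM normr_walsh mul1r normrX.
  (* Since [k >= 2], the new exponent [(i + 1) * k] is at least [i + 2], and [r <= 1]. *)
  apply: le_trans (_ : (r ^+ i.+1) ^+ k <= _).
    by apply: lerXn2r; rewrite ?nnegrE ?exprn_ge0 ?normr_ge0.
  rewrite -exprM ler_wiXn2l ?normr_ge0 ?ltW //.
  by rewrite (leq_trans _ (leq_mul (leqnn i.+1) k2)) // muln2 doubleS !ltnS -addnn leq_addl.
apply: norm_cvg0.
apply: (@squeeze_cvgr _ _ _ _ (cst 0) (fun i => r ^+ i.+1)).
- by near=> i; rewrite normr_ge0 bound.
- exact: cvg_cst.
- rewrite (_ : (fun i => _) = (fun i => [eta GRing.exp r] (i + 1)%N)); last first.
    by apply/funext => i; rewrite addn1.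
  rewrite (cvg_shiftn 1 (GRing.exp r : nat -> R)).
  by apply: cvg_expr; rewrite normr_id.
Unshelve. all: by end_near. Qed.

(** The sequence is constant only from step 1 on: at step 0 the coefficient is [e]. Afterwards
    [e ^ (k * k) = e ^ k], because [k * k] and [k] have the same parity. *)
Lemma fourier_growth_const mu t (e : R) i :
  walsh R t (const_fun n c) = 1 -> fourier mu t = e -> e * e = 1 ->
  fourier (growth mu alpha i.+1) t = e ^+ k.
Proof.
move=> tc te ee; elim: i => [|i IH]; rewrite fourier_growthS tc mul1r ?IH.
  by rewrite /= te.
by rewrite -exprM (expr_odd _ ee) oddM andbb -expr_odd.
Qed.

(** Criterion shared by the three cases. The closure of [L] under differences of elements of [S]
    kills its coefficients at characters that vary on [S]; the last hypothesis matches the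
    coefficients at the other characters. *)
Lemma growth_cvg_uniform S L : (2 <= k)%N -> (0 < #|S|)%N -> (0 < #|L|)%N ->
  {in S &, forall s s', {in L, forall f, add_fun f (add_fun s s') \in L}} ->
  (forall t (e : R), e * e = 1 -> {in S, forall s, walsh R t s = e} ->
     walsh R t (const_fun n c) = 1 /\ {in L, forall f, walsh R t f = e ^+ k}) ->
  limiting_distribution (uniform_on R S) alpha (uniform_on R L).
Proof.
move=> k2 S0 L0 shiftL constL f.
rewrite fourier_inversion.
(* By inversion it suffices to pass to the limit in each Fourier coefficient, since the sum over [t]
   is finite. *)
rewrite (_ : (fun i => _) = fun i => #|{: boolfun n}|%:R^-1 *
    \sum_t fourier (growth (uniform_on R S) alpha i) t * walsh R t f); last first.
  by apply/funext => i; rewrite -fourier_inversion.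
apply: cvgMl_tmp.
have /card_gt0P[s sS] := S0.
apply: cvg_big => [|t _]; first exact: add_continuous.
apply: cvgMr_tmp.
case: (boolP [forall s' in S, walsh R t s == walsh R t s']) => [/forall_inP tS|].
  have [|tc tL] := constL t (walsh R t s) (walsh_sqr _ _ _).
    by move=> s' /tS/eqP.
  (* The shift of the index drops step 0, where the coefficient need not yet be [e ^ k]. *)
  rewrite (fourier_uniform_const L0 tL) -(cvg_shiftS _).
  under eq_fun => i.
    rewrite (fourier_growth_const (e := walsh R t s)) ?walsh_sqr //; last first.
      by apply: fourier_uniform_const => // s' /tS/eqP.
    over.
  exact: cvg_cst.
move=> /forall_inPn[s' s'S tss'].
(* The character separates [s] and [s'], so it takes the value -1 at their sum, and [L] is stable
   under adding that sum. *)
rewrite (@fourier_uniform_shift _ _ L t (add_fun s s')).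
- by apply: fourier_growth_cvg0 => //; apply: (fourier_uniform_lt1 sS s'S).
- by rewrite walshD walshM_neq.
- exact: shiftL.
Qed.

End Growth.

(** * Linear functions and the parity of their number of variables *)

Section LinearFunctions.
Variable n : nat.
Implicit Types (c d : bvec n) (f : boolfun n).

(** Written as a sum in GF(2) so that additivity is immediate; [odd_card_parity] ties it to the
    cardinality in the limit sets. *)
Definition parity c : bool := \big[addb/false]_(j < n) c j.

Definition unit_vec (i : 'I_n) : bvec n := [ffun j => j == i].

Lemma odd_card_parity c : odd #|[set j | c j]| = parity c.
Proof.
rewrite -sum1_card (big_morph odd oddD (erefl : odd 0 = false)) big_mkcond.
by apply: eq_bigr => j _; rewrite inE; case: (c j).
Qed.

Lemma parityD c d : parity [ffun j => c j (+) d j] = parity c (+) parity d.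
Proof. by rewrite /parity -big_split; apply: eq_bigr => j _; rewrite ffunE. Qed.

Lemma parity_unit i : parity (unit_vec i) = true.
Proof.
rewrite /parity (bigD1 i) //= ffunE eqxx big1 // => j /negPf.
by rewrite ffunE.
Qed.

Lemma parity0 : parity [ffun=> false] = false.
Proof. by rewrite /parity big1 // => j _; rewrite ffunE. Qed.

Lemma add_linear_fun b b' c d :
  add_fun (linear_fun b c) (linear_fun b' d) =
  linear_fun (b (+) b') [ffun j => c j (+) d j].
Proof.
apply/ffunP => x; rewrite !ffunE addbACA -big_split; congr (_ (+) _).
by apply: eq_bigr => j _; rewrite ffunE andb_addl.
Qed.

Lemma proj_linear i : proj_fun i = linear_fun false (unit_vec i).
Proof.
apply/ffunP => x; rewrite !ffunE (bigD1 i) //= ffunE eqxx big1 ?addbF // => j /negPf.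
by rewrite ffunE => ->.
Qed.

Lemma neg_proj_linear i : neg_fun (proj_fun i) = linear_fun true (unit_vec i).
Proof. by rewrite proj_linear; apply/ffunP => x; rewrite !ffunE. Qed.

Lemma const_linear b : const_fun n b = linear_fun b [ffun=> false].
Proof.
apply/ffunP => x; rewrite !ffunE big1 ?addbF // => j _.
by rewrite ffunE.
Qed.

Lemma linear_funsP f :
  reflect (exists b c, f = linear_fun b c) (f \in linear_funs n).
Proof.
rewrite inE; apply: (iffP existsP) => [[b /existsP[c /eqP->]]|[b [c ->]]].
  by exists b, c.
by exists b; apply/existsP; exists c.
Qed.

Lemma odd_linear_funsP f :
  reflect (exists b c, f = linear_fun b c /\ parity c) (f \in odd_linear_funs n).
Proof.
rewrite inE; apply: (iffP existsP) => [[b /existsP[c]]|[b [c [-> hc]]]].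
  by rewrite odd_card_parity => /andP[/eqP-> hc]; exists b, c.
by exists b; apply/existsP; exists c; rewrite odd_card_parity eqxx.
Qed.

Lemma even_linear_funsP f :
  reflect (exists b c, f = linear_fun b c /\ ~~ parity c) (f \in even_linear_funs n).
Proof.
rewrite inE; apply: (iffP existsP) => [[b /existsP[c]]|[b [c [-> hc]]]].
  by rewrite odd_card_parity => /andP[/eqP-> hc]; exists b, c.
by exists b; apply/existsP; exists c; rewrite odd_card_parity eqxx.
Qed.

Lemma A0_nonconst_odd f :
  f \in A0 n -> f \notin consts n -> f \in odd_linear_funs n.
Proof.
case/finset.setUP=> [|-> //] /finset.setUP[] /imsetP[i _ ->] _; apply/odd_linear_funsP.
- by exists false, (unit_vec i); rewrite -proj_linear parity_unit.
- by exists true, (unit_vec i); rewrite -neg_proj_linear parity_unit.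
Qed.

Lemma A0_linear f : f \in A0 n -> f \in linear_funs n.
Proof.
have [/finset.set2P cf _|cf fA0] := boolP (f \in consts n).
  apply/linear_funsP; case: cf => ->.
  - by exists false, [ffun=> false]; rewrite -const_linear.
  - by exists true, [ffun=> false]; rewrite -const_linear.
have /odd_linear_funsP[b [c [-> _]]] := A0_nonconst_odd fA0 cf.
by apply/linear_funsP; exists b, c.
Qed.

(** Expresses a linear function as a sum in the group, so that a character can be evaluated factor
    by factor. *)
Lemma linear_fun_add b c :
  linear_fun b c =
  add_fun (const_fun n b)
    (\big[@add_fun n/const_fun n false]_(j < n | c j) proj_fun j).
Proof.
apply/ffunP => x; rewrite !ffunE; congr (_ (+) _).
rewrite (big_morph (fun f : boolfun n => f x) (id1 := false) (op1 := addb)).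
- rewrite [RHS]big_mkcond; apply: eq_bigr => j _.
  by rewrite ffunE; case: (c j).
- by move=> f g; rewrite ffunE.
- by rewrite ffunE.
Qed.

(** The constant term contributes 1 and each variable present contributes [e]; as [e * e = 1], only
    the parity of their number remains. *)
Lemma walsh_linear_fun (R : realType) t (e : R) b c : e * e = 1 ->
  walsh R t (const_fun n true) = 1 ->
  (forall i, walsh R t (proj_fun i) = e) ->
  walsh R t (linear_fun b c) = e ^+ parity c.
Proof.
move=> ee t1 te; rewrite linear_fun_add walshD.
have -> : walsh R t (const_fun n b) = 1 by case: b; rewrite ?walsh0.
rewrite mul1r (big_morph _ (walshD R t) (walsh0 R t)) /parity.
rewrite (big_morph (fun d : bool => e ^+ d) (id1 := 1) (op1 := *%R)) //.
  by rewrite big_mkcond; apply: eq_bigr => j _; rewrite te; case: (c j).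
by case=> [] []; rewrite /= ?expr0 ?expr1 ?mulr1 ?mul1r ?ee.
Qed.

End LinearFunctions.

(** * The three limit sets *)

Lemma supp_uniform (R : realType) n (S : {set boolfun n}) :
  supp (uniform_on R S) = S.
Proof.
apply/setP => f; rewrite inE /uniform_on; case: ifP => [fS|_]; last by rewrite ltxx.
by rewrite invr_gt0 ltr0n; apply/card_gt0P; exists f.
Qed.

Close Scope ring_scope.

Theorem theorem3p3 (R : realType) (k n : nat) (hk : (2 <= k)%N) (hn : (1 <= n)%N)
    (c : bool) (alpha : boolfun k)
    (halpha : forall y : bvec k, alpha y = c (+) \big[addb/false]_(j < k) y j)
    (mu : boolfun n -> R) (hmu : initial_distribution mu)
    (hneg : neg_projs n \subset supp mu) :
  [/\ [disjoint consts n & supp mu] -> odd k ->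
        limiting_distribution mu alpha (uniform_on R (odd_linear_funs n)),
      [disjoint consts n & supp mu] -> ~~ odd k ->
        limiting_distribution mu alpha (uniform_on R (even_linear_funs n))
    & ~~ [disjoint consts n & supp mu] ->
        limiting_distribution mu alpha (uniform_on R (linear_funs n))].
Proof.
case: hmu hneg => S [SA0 projS _ ->]; rewrite supp_uniform => negS.
pose i0 := Ordinal hn.
have pS i : proj_fun i \in S by apply: (fintype.subsetP projS); apply: imset_f.
have nS i : neg_fun (proj_fun i) \in S by apply: (fintype.subsetP negS); apply: imset_f.
have S0 : (0 < #|S|)%N by apply/card_gt0P; exists (proj_fun i0).
(* Without constants, every element of [S] has exactly one variable, so a sum of two has an even
   number. *)
have sum_linear s s' : s \in S -> s' \in S ->
    exists b d, add_fun s s' = linear_fun b d /\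
      ([disjoint consts n & S] -> ~~ parity d).
  move=> sS s'S; case: (boolP [disjoint consts n & S]) => [dis|_].
    have oddS u : u \in S -> u \in odd_linear_funs n.
      move=> uS; apply: A0_nonconst_odd; first exact: (fintype.subsetP SA0).
      by rewrite (disjointFl dis uS).
    have /odd_linear_funsP[b [d [-> hd]]] := oddS _ sS.
    have /odd_linear_funsP[b' [d' [-> hd']]] := oddS _ s'S.
    by rewrite add_linear_fun; do 2!eexists; split=> // _; rewrite parityD hd hd'.
  have /linear_funsP[b [d ->]] := A0_linear (fintype.subsetP SA0 _ sS).
  have /linear_funsP[b' [d' ->]] := A0_linear (fintype.subsetP SA0 _ s'S).
  by rewrite add_linear_fun; do 2!eexists.
have walsh_true t (e : R) : (e * e = 1)%R -> {in S, forall s, walsh R t s = e} ->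
    walsh R t (const_fun n true) = 1%R.
  move=> ee te.
  (* A projection and its negation both lie in [S] and add up to the constant 1, where the character
     is therefore [e * e]. *)
  have -> : const_fun n true = add_fun (proj_fun i0) (neg_fun (proj_fun i0)).
    by apply/ffunP => x; rewrite !ffunE addbN addbb.
  by rewrite walshD !te.
have walsh_lin t (e : R) b d : (e * e = 1)%R -> {in S, forall s, walsh R t s = e} ->
    walsh R t (linear_fun b d) = (e ^+ parity d)%R.
  by move=> ee te; apply: walsh_linear_fun; [|exact: walsh_true te|move=> i; exact: te].
have walsh_c t (e : R) : (e * e = 1)%R -> {in S, forall s, walsh R t s = e} ->
    walsh R t (const_fun n c) = 1%R.
  by move=> ee te; rewrite const_linear (walsh_lin _ e) // parity0.
split=> [dis oddk|dis evenk|meet].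
- apply: (growth_cvg_uniform halpha) => //.
  + by apply/card_gt0P; exists (proj_fun i0); apply/odd_linear_funsP;
      exists false, (unit_vec i0); rewrite proj_linear parity_unit.
  + move=> s s' sS s'S f /odd_linear_funsP[b [d [-> hd]]].
    have [b' [d' [-> /(_ dis) hd']]] := sum_linear s s' sS s'S.
    apply/odd_linear_funsP; rewrite add_linear_fun; do 2!eexists; split=> //.
    by rewrite parityD hd (negPf hd').
  + move=> t e ee te; split; first exact: walsh_c te.
    move=> f /odd_linear_funsP[b [d [-> hd]]].
    (* An odd number of variables gives [e], and so does [e ^ k] for odd [k]; in the even case below
       both sides are 1. *)
    by rewrite (walsh_lin t e) // hd (expr_odd k ee) oddk.
- apply: (growth_cvg_uniform halpha) => //.
  + by apply/card_gt0P; exists (const_fun n false); apply/even_linear_funsP;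
      exists false, [ffun=> false]; rewrite const_linear parity0.
  + move=> s s' sS s'S f /even_linear_funsP[b [d [-> hd]]].
    have [b' [d' [-> /(_ dis) hd']]] := sum_linear s s' sS s'S.
    apply/even_linear_funsP; rewrite add_linear_fun; do 2!eexists; split=> //.
    by rewrite parityD (negPf hd) (negPf hd').
  + move=> t e ee te; split; first exact: walsh_c te.
    move=> f /even_linear_funsP[b [d [-> hd]]].
    by rewrite (walsh_lin t e) // (negPf hd) (expr_odd k ee) (negPf evenk).
- apply: (growth_cvg_uniform halpha) => //.
  + by apply/card_gt0P; exists (const_fun n false); apply/linear_funsP;
      exists false, [ffun=> false]; rewrite const_linear.
  + move=> s s' sS s'S f /linear_funsP[b [d ->]].
    have [b' [d' [-> _]]] := sum_linear s s' sS s'S.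
    by apply/linear_funsP; rewrite add_linear_fun; do 2!eexists.
  + move=> t e ee te; split; first exact: walsh_c te.
    move=> f /linear_funsP[b [d ->]].
    (* A constant in [S] forces the common value to be 1, since the character is 1 at both
       constants; parity then no longer matters. *)
    have e1 : e = 1%R.
      have /pred0Pn[h /andP[/= hc hS]] := meet.
      rewrite -(te h hS); case/finset.set2P: hc => ->; first exact: walsh0.
      exact: walsh_true te.
    by rewrite (walsh_lin t e) // e1 !expr1n.
Qed.
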